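(* Let $m,n\in\mathbb{N}$ and let $A$ be any complex matrix of size $2^m\times 2^n$. Then $A$ can be represented by a ZX diagram, i.e. there exists a diagram $D:n\to m$ of the algebraic ZX-calculus such that $\llbracket D\rrbracket = A$.
   Context: $\mathbb{N}$ includes $0$. Write $\ket{0}=\begin{pmatrix}1\\0\end{pmatrix}$, $\ket{1}=\begin{pmatrix}0\\1\end{pmatrix}$, $\bra{0}=\begin{pmatrix}1&0\end{pmatrix}$, $\bra{1}=\begin{pmatrix}0&1\end{pmatrix}$, where $\ket{v}$ denotes a column vector and $\bra{v}$ a row vector; a $0$-fold tensor power is the $1\times1$ matrix $(1)$. A diagram $D:n\to m$ (with $n$ inputs and $m$ outputs) of the algebraic ZX-calculus is a formal expression built from the generators below and the empty diagram $0\to 0$ by finitely many applications of parallel composition $D_1\otimes D_2:n_1+n_2\to m_1+m_2$ (for $D_1:n_1\to m_1$, $D_2:n_2\to m_2$) and sequential composition $D_1\circ D_2:n\to m$ (for $D_2:n\to k$, $D_1:k\to m$). Its standard interpretation $\llbracket D\rrbracket$ is the complex matrix of size $2^m\times 2^n$ determined by $\llbracket D_1\otimes D_2\rrbracket=\llbracket D_1\rrbracket\otimes\llbracket D_2\rrbracket$ (Kronecker product), $\llbracket D_1\circ D_2\rrbracket=\llbracket D_1\rrbracket\,\llbracket D_2\rrbracket$ (matrix product), $\llbracket\text{empty diagram}\rrbracket=1$, and the following values on the generators: - green spider $R_{Z,a}^{(n,m)}:n\to m$, for all $n,m\in\mathbb{N}$ and $a\in\mathbb{C}$: $\ket{0}^{\otimes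 m}\bra{0}^{\otimes n}+a\,\ket{1}^{\otimes m}\bra{1}^{\otimes n}$; - identity wire $\mathbb{I}:1\to1$: $\begin{pmatrix}1&0\\0&1\end{pmatrix}$; - Hadamard $H:1\to1$: $\begin{pmatrix}1&1\\1&-1\end{pmatrix}$; - swap $\sigma:2\to2$: $\begin{pmatrix}1&0&0&0\\0&0&1&0\\0&1&0&0\\0&0&0&1\end{pmatrix}$; - cap $C_a:0\to2$: $\begin{pmatrix}1\\0\\0\\1\end{pmatrix}$; - cup $C_u:2\to0$: $\begin{pmatrix}1&0&0&1\end{pmatrix}$; - triangle $T:1\to1$: $\begin{pmatrix}1&1\\0&1\end{pmatrix}$; - inverse triangle $T^{-1}:1\to1$: $\begin{pmatrix}1&-1\\0&1\end{pmatrix}$. *)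

(* Defs.v *)
From mathcomp Require Import all_boot all_order all_algebra.
From mathcomp Require Import mxtens.

Set Implicit Arguments.
Unset Strict Implicit.
Unset Printing Implicit Defensive.

Import GRing.Theory.
Local Open Scope ring_scope.

(* [Seq D1 D2] is D1 \o D2: D2 is performed first. *)
Inductive zx (K : Type) : nat -> nat -> Type :=
| Empty : zx K 0 0
| Spider (n m : nat) (a : K) : zx K n m
| Wire : zx K 1 1
| Hadamard : zx K 1 1
| Swap : zx K 2 2
| Cap : zx K 0 2
| Cup : zx K 2 0
| Triangle : zx K 1 1
| TriangleInv : zx K 1 1
| Par (n1 m1 n2 m2 : nat) (D1 : zx K n1 m1) (D2 : zx K n2 m2) :
    zx K (n1 + n2) (m1 + m2)
| Seq (n k m : nat) (D1 : zx K k m) (D2 : zx K n k) : zx K n m.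

Definition mx_of_rows (K : pzRingType) (m n : nat) (rows : seq (seq K)) :
    'M[K]_(m, n) :=
  \matrix_(i < m, j < n) (nth [::] rows i)`_j.

Fixpoint tenspow (K : pzRingType) (p q : nat) (A : 'M[K]_(p, q)) (k : nat) :
    'M[K]_(p ^ k, q ^ k) :=
  match k with
  | 0 => 1%:M
  | k'.+1 => castmx (esym (expnS p k'), esym (expnS q k')) (A *t tenspow A k')
  end.

(* The casts identify 1 ^ k with 1. *)
Definition ketpow (K : pzRingType) (v : 'cV[K]_2) (k : nat) : 'cV[K]_(2 ^ k) :=
  castmx (erefl (2 ^ k)%N, exp1n k) (tenspow v k).

Definition brapow (K : pzRingType) (v : 'rV[K]_2) (k : nat) : 'rV[K]_(2 ^ k) :=
  castmx (exp1n k, erefl (2 ^ k)%N) (tenspow v k).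

Definition ket0 (K : pzRingType) : 'cV[K]_2 := mx_of_rows 2 1 [:: [:: 1]; [:: 0]].
Definition ket1 (K : pzRingType) : 'cV[K]_2 := mx_of_rows 2 1 [:: [:: 0]; [:: 1]].
Definition bra0 (K : pzRingType) : 'rV[K]_2 := mx_of_rows 1 2 [:: [:: 1; 0]].
Definition bra1 (K : pzRingType) : 'rV[K]_2 := mx_of_rows 1 2 [:: [:: 0; 1]].

Definition spider_mx (K : pzRingType) (n m : nat) (a : K) :
    'M[K]_(2 ^ m, 2 ^ n) :=
  ketpow (ket0 K) m *m brapow (bra0 K) n
  + a *: (ketpow (ket1 K) m *m brapow (bra1 K) n).

Fixpoint interp (K : pzRingType) (n m : nat) (D : zx K n m) :
    'M[K]_(2 ^ m, 2 ^ n) :=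
  match D in zx _ n m return 'M[K]_(2 ^ m, 2 ^ n) with
  | Empty => 1%:M
  | Spider n m a => spider_mx n m a
  | Wire => mx_of_rows (2 ^ 1) (2 ^ 1) [:: [:: 1; 0]; [:: 0; 1]]
  | Hadamard => mx_of_rows (2 ^ 1) (2 ^ 1) [:: [:: 1; 1]; [:: 1; -1]]
  | Swap => mx_of_rows (2 ^ 2) (2 ^ 2)
      [:: [:: 1; 0; 0; 0]; [:: 0; 0; 1; 0]; [:: 0; 1; 0; 0]; [:: 0; 0; 0; 1]]
  | Cap => mx_of_rows (2 ^ 2) (2 ^ 0) [:: [:: 1]; [:: 0]; [:: 0]; [:: 1]]
  | Cup => mx_of_rows (2 ^ 0) (2 ^ 2) [:: [:: 1; 0; 0; 1]]
  | Triangle => mx_of_rows (2 ^ 1) (2 ^ 1) [:: [:: 1; 1]; [:: 0; 1]]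
  | TriangleInv => mx_of_rows (2 ^ 1) (2 ^ 1) [:: [:: 1; -1]; [:: 0; 1]]
  | Par n1 m1 n2 m2 D1 D2 =>
      castmx (esym (expnD 2 m1 m2), esym (expnD 2 n1 n2))
        (interp D1 *t interp D2)
  | Seq _ _ _ D1 D2 => interp D1 *m interp D2
  end.

(* Main.v *)
(** Every state is an entrywise product, over the bitstrings [a], of vectors
    [J + c e_a] with [J] the all-ones vector, and entrywise products are
    computed by merging wires pairwise with green spiders. The vector
    [J + c e_a] is obtained from the spider [e_(0..0) + c e_(1..1)] by applying
    to the wire [i] the gate with columns [(1, 1)] and [e_(a_i)], which is
    assembled from Hadamards, triangles and the phases [1/2], [-1/2]. A matrix
    follows from a state by bending wires one at a time with a cup. *)
Require Import Defs.
From mathcomp Require Import all_boot all_order all_algebra.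
From mathcomp Require Import complex reals mxtens ring.

Set Implicit Arguments.
Unset Strict Implicit.
Unset Printing Implicit Defensive.

Import GRing.Theory.
Local Open Scope ring_scope.

(** * Bitstrings as matrix indices *)

(* The lexicographic order matches the Kronecker product: the leftmost factor
   carries the most significant bit. *)
Fixpoint words (n : nat) : seq bitseq :=
  if n is n'.+1 then
    [seq false :: w | w <- words n'] ++ [seq true :: w | w <- words n']
  else [:: [::]].

Definition bits (n i : nat) : bitseq := nth [::] (words n) i.

Lemma size_words n : size (words n) = (2 ^ n)%N.
Proof.
by elim: n => //= n IHn; rewrite size_cat !size_map IHn addnn expnS mul2n.
Qed.

Lemma mem_words n w : (w \in words n) = (size w == n).
Proof.
elim: n w => [|n IHn] w; first by rewrite inE; case: w.
rewrite mem_cat; case: w => [|b w] /=.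
  by apply/orP => -[] /mapP [].
have inj (c : bool) : injective (cons c) by move=> s t [].
have notin (c d : bool) s : c != d -> (c :: w \in [seq d :: x | x <- s]) = false.
  by move=> cd; apply/mapP => -[x _ [e _]]; rewrite e eqxx in cd.
by case: b; rewrite (mem_map (inj _)) notin // ?orbF IHn.
Qed.

Lemma uniq_words n : uniq (words n).
Proof.
elim: n => //= n IHn; rewrite cat_uniq !map_inj_uniq ?IHn; try by move=> s t [].
by rewrite andbT; apply/hasPn => _ /mapP [w _ ->]; apply/mapP => -[].
Qed.

Lemma size_bits n i : (i < 2 ^ n)%N -> size (bits n i) = n.
Proof.
by move=> lti; apply/eqP; rewrite -mem_words mem_nth // size_words.
Qed.

Lemma bits_inj n i j :
  (i < 2 ^ n)%N -> (j < 2 ^ n)%N -> bits n i = bits n j -> i = j.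
Proof.
by move=> lti ltj /eqP; rewrite nth_uniq ?size_words ?uniq_words // => /eqP.
Qed.

(** By induction on [m]: the leading bit tells whether [i], and with it the combined index, lies in
    the first or the second half of its range. *)
Lemma bits_cat m n i j : (i < 2 ^ m)%N -> (j < 2 ^ n)%N ->
  bits (m + n) (i * 2 ^ n + j) = bits m i ++ bits n j.
Proof.
elim: m i => [|m IHm] i; first by case: i.
move=> lti ltj; rewrite addSn /bits /= !nth_cat !size_map !size_words.
have lt_block k : (k < 2 ^ m)%N -> (k * 2 ^ n + j < 2 ^ (m + n))%N.
  move=> ltk; apply: (@leq_trans (k.+1 * 2 ^ n)).
    by rewrite mulSn addnC ltn_add2r.
  by rewrite expnD leq_mul2r ltk orbT.
case: (ltnP i (2 ^ m)) => [ltim | leim].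
  by rewrite lt_block // !(nth_map [::]) ?size_words ?lt_block //= -/(bits _ _) IHm.
have ltk : (i - 2 ^ m < 2 ^ m)%N by rewrite ltn_subLR // addnn -mul2n -expnS.
have -> : (i * 2 ^ n + j = 2 ^ (m + n) + ((i - 2 ^ m) * 2 ^ n + j))%N.
  by rewrite expnD addnA -mulnDl subnKC.
rewrite ltnNge leq_addr /= addKn !(nth_map [::]) ?size_words ?lt_block //=.
by rewrite -/(bits _ _) IHm.
Qed.

Lemma sum_words (V : nmodType) n (F : bitseq -> V) :
  \sum_(i < 2 ^ n) F (bits n i) = \sum_(w <- words n) F w.
Proof. by rewrite (big_nth [::]) size_words big_mkord. Qed.

Lemma sum_words_pred1 (K : pzSemiRingType) n w (F : bitseq -> K) : size w = n ->
  \sum_(z <- words n) (z == w)%:R * F z = F w.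
Proof.
move=> /eqP; rewrite -mem_words => w_in.
rewrite (bigD1_seq w) ?uniq_words //= eqxx mul1r big1 ?addr0 // => z /negbTE ->.
by rewrite mul0r.
Qed.

(** Turns the index pairs of [*t] into concatenation of words, so that Kronecker products can be
    computed bitwise. *)
Lemma split_bits p q (k : 'I_(2 ^ (p + q))) :
  exists2 ab : 'I_(2 ^ p) * 'I_(2 ^ q),
    cast_ord (expnD 2 p q) k = mxtens_index ab &
    bits (p + q) k = bits p ab.1 ++ bits q ab.2.
Proof.
case E: _ / (mxtens_indexP (cast_ord (expnD 2 p q) k)) => [a b].
exists (a, b) => //=; rewrite -bits_cat //.
by have /= <- := congr1 val E.
Qed.

(** * Entries of spiders *)

Lemma trmx_tenspow (K : pzRingType) p q (A : 'M[K]_(p, q)) k :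
  (tenspow A k)^T = tenspow A^T k.
Proof.
elim: k => [|k IHk] /=; first by rewrite trmx1.
by rewrite trmx_cast trmx_tens IHk.
Qed.

(** The hypothesis makes [v] the basis vector of the bit [b], which treats [ket0] and [ket1] at
    once. *)
Lemma tenspow_ketE (K : pzRingType) (v : 'cV[K]_2) (b : bool) k i j :
  (forall a, v a 0 = (bits 1 a == [:: b])%:R) ->
  tenspow v k i j = (bits k i == nseq k b)%:R.
Proof.
move=> vE; elim: k i j => [|k IHk] i j; first by rewrite !ord1 mxE eqxx.
rewrite /= castmxE !esymK.
have -> : cast_ord (expnS 2 k) i = cast_ord (expnD 2 1 k) i by apply: val_inj.
have [[a c] -> bitsE] := @split_bits 1 k i.
rewrite -[bits k.+1 i]/(bits (1 + k) i) bitsE /=.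
case: (mxtens_indexP (cast_ord _ j)) => d e.
rewrite tensmxE IHk [d]ord1 vE -natrM mulnb.
by have := size_bits (ltn_ord a); case: bits => [|? []] //= _;
  rewrite !eqseq_cons andbT.
Qed.

Lemma ketpowE (K : pzRingType) (v : 'cV[K]_2) (b : bool) k i j :
  (forall a, v a 0 = (bits 1 a == [:: b])%:R) ->
  ketpow v k i j = (bits k i == nseq k b)%:R.
Proof. by move=> vE; rewrite castmxE (tenspow_ketE _ _ vE) cast_ord_id. Qed.

Lemma brapowE (K : pzRingType) (v : 'rV[K]_2) (b : bool) k i j :
  (forall a, v 0 a = (bits 1 a == [:: b])%:R) ->
  brapow v k i j = (bits k j == nseq k b)%:R.
Proof.
move=> vE; rewrite castmxE -[tenspow v k]trmxK trmx_tenspow mxE.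
by rewrite (@tenspow_ketE _ _ b) ?cast_ord_id // => a; rewrite mxE.
Qed.

Lemma spider_mxE (K : pzRingType) n m (a : K) i j :
  spider_mx n m a i j =
  (bits m i == nseq m false)%:R * (bits n j == nseq n false)%:R
  + a * ((bits m i == nseq m true)%:R * (bits n j == nseq n true)%:R).
Proof.
rewrite !mxE !big_ord1.
rewrite (@ketpowE _ _ false) ?(@ketpowE _ _ true);
  try by case=> [[|[]]] //= ?; rewrite mxE.
rewrite (@brapowE _ _ false) ?(@brapowE _ _ true) //;
  by case=> [[|[]]] //= ?; rewrite mxE.
Qed.

(** * Functions on bitstrings realized by diagrams *)

Section Realizable.

Variable K : fieldType.

(* [f] takes the output bits first, like the row index of [interp D]. *)
Definition realizable n m (f : bitseq -> bitseq -> K) : Prop :=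
  exists D : zx K n m, forall i j, interp D i j = f (bits m i) (bits n j).

Lemma eq_realizable n m f g :
  (forall x y, size x = m -> size y = n -> f x y = g x y) ->
  realizable n m f -> realizable n m g.
Proof.
move=> fg [D D_f]; exists D => i j.
by rewrite D_f fg ?size_bits.
Qed.

Lemma realizable_par n1 m1 n2 m2 f g :
  realizable n1 m1 f -> realizable n2 m2 g ->
  realizable (n1 + n2) (m1 + m2)
    (fun x y => f (take m1 x) (take n1 y) * g (drop m1 x) (drop n1 y)).
Proof.
move=> [D1 D1f] [D2 D2g]; exists (Par D1 D2) => i j /=.
rewrite castmxE !esymK.
have [[a b] -> ->] := split_bits i; have [[c d] -> ->] := split_bits j.
by rewrite tensmxE D1f D2g /= !take_size_cat ?drop_size_cat ?size_bits.
Qed.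

Lemma realizable_seq n k m f g :
  realizable k m f -> realizable n k g ->
  realizable n m (fun x y => \sum_(z <- words k) f x z * g z y).
Proof.
move=> [D1 D1f] [D2 D2g]; exists (Seq D1 D2) => i j /=.
by rewrite mxE -sum_words; apply: eq_bigr => z _; rewrite D1f D2g.
Qed.

Lemma realizable_spider n m (a : K) :
  realizable n m (fun x y =>
    (x == nseq m false)%:R * (y == nseq n false)%:R
    + a * ((x == nseq m true)%:R * (y == nseq n true)%:R)).
Proof. by exists (Spider n m a) => i j; rewrite /= spider_mxE. Qed.

(** A word of length two is a palindrome exactly when its bits agree. *)
Lemma realizable_cup : realizable 2 0 (fun x y => (y == rev y)%:R).
Proof.
by exists (Cup K); case=> [[|i] lti] // [[|[|[|[|j]]]] ltj]; rewrite // mxE.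
Qed.

(** * Wirings *)

(* Output bits [x] determine input bits [h x], so that composing with a wiring
   substitutes [h x] for [x]. *)
Definition wiring n m (h : bitseq -> bitseq) : Prop :=
  (forall x, size x = m -> size (h x) = n) /\
  realizable n m (fun x y => (y == h x)%:R).

Lemma eq_wiring n m h h' :
  (forall x, size x = m -> h x = h' x) -> wiring n m h -> wiring n m h'.
Proof.
move=> hh' [size_h rh]; split=> [x sx|]; first by rewrite -hh' ?size_h.
by apply: eq_realizable rh => x y sx _; rewrite hh'.
Qed.

Lemma wiring_par n1 m1 n2 m2 h1 h2 : wiring n1 m1 h1 -> wiring n2 m2 h2 ->
  wiring (n1 + n2) (m1 + m2) (fun x => h1 (take m1 x) ++ h2 (drop m1 x)).
Proof.
move=> [size_h1 rh1] [size_h2 rh2].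
have size_h x : size x = (m1 + m2)%N ->
    size (h1 (take m1 x)) = n1 /\ size (h2 (drop m1 x)) = n2.
  by move=> sx; rewrite size_h1 ?size_h2 ?size_drop ?size_takel
    ?sx ?addKn ?leq_addr.
split=> [x /size_h [s1 s2]|]; first by rewrite size_cat s1 s2.
apply: eq_realizable (realizable_par rh1 rh2) => x y /size_h [s1 s2] sy.
rewrite -natrM mulnb -{3}(cat_take_drop n1 y) eqseq_cat //.
by rewrite s1 size_takel // sy leq_addr.
Qed.

Lemma realizable_wiring_seq n k m h g : wiring k m h -> realizable n k g ->
  realizable n m (fun x y => g (h x) y).
Proof.
move=> [size_h rh] rg; apply: eq_realizable (realizable_seq rh rg) => x y sx _.
by rewrite (@sum_words_pred1 _ _ _ (fun z => g z y)) ?size_h.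
Qed.

Lemma wiring_seq n k m h1 h2 : wiring k m h1 -> wiring n k h2 ->
  wiring n m (h2 \o h1).
Proof.
move=> w1 [size_h2 rh2]; split=> [x sx|]; first by rewrite size_h2 ?(proj1 w1).
exact: (realizable_wiring_seq w1 rh2).
Qed.

Lemma wiring_empty : wiring 0 0 id.
Proof.
split=> //; exists (Empty K) => i j.
by rewrite !ord1 mxE eqxx.
Qed.

Lemma wiring_wire : wiring 1 1 id.
Proof.
by split=> //; exists (Wire K); case=> [[|[|i]] ?] // [[|[|j]] ?]; rewrite // mxE.
Qed.

Lemma wiring_wires n : wiring n n id.
Proof.
elim: n => [|n IHn]; first exact: wiring_empty.
apply: eq_wiring (wiring_par wiring_wire IHn) => x _.
exact: cat_take_drop.
Qed.

Lemma wiring_swap : wiring 2 2 rev.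
Proof.
split=> [x <-|]; first exact: size_rev.
exists (Swap K); case=> [[|[|[|[|i]]]] lti] // [[|[|[|[|j]]]] ltj];
  by rewrite // mxE.
Qed.

(** Swapping the first two bits and then rotating all but the first carries the leading bit to the
    end. *)
Lemma wiring_rot n : wiring n.+1 n.+1 (rot 1).
Proof.
elim: n => [|n IHn].
  by apply: eq_wiring wiring_wire; case=> [|a []].
have w1 := wiring_par wiring_wire IHn.
have w2 := wiring_par wiring_swap (wiring_wires n).
apply: eq_wiring (wiring_seq w2 w1) => -[|a [|b x]] //= _.
by rewrite !take0 !drop0 !rot1_cons.
Qed.

Lemma wiring_merge n : wiring (n + n) n (fun x => x ++ x).
Proof.
elim: n => [|n IHn]; first by apply: eq_wiring wiring_empty; case.
have w1 : wiring 2 1 (fun x => x ++ x).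
  split=> [x sx|]; first by rewrite size_cat sx.
  (* With phase 1 this spider has entry 1 exactly where all three bits agree. *)
  apply: eq_realizable (realizable_spider 2 1 1).
  by case=> [|[] []] // [|[] [|[] []]] // _ _;
    rewrite /= ?(mul1r, mul0r, mulr0, addr0, add0r).
(* Merging bitwise turns [a :: x] into [a :: a :: x ++ x]; rotating the second [a] past the first
   [x] gives the doubled word. *)
have w2 := wiring_par wiring_wire (wiring_par (wiring_rot n) (wiring_wires n)).
rewrite addnS; apply: eq_wiring (wiring_seq (wiring_par w1 IHn) w2).
case=> [|a x] //= [sx]; rewrite !take0 !drop0 /=.
by rewrite -cat_cons take_size_cat ?drop_size_cat /= ?sx // rot1_cons -cats1 -catA.
Qed.

Lemma realizable_state_mul m f g :
  realizable 0 m f -> realizable 0 m g ->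
  realizable 0 m (fun x y => f x y * g x y).
Proof.
move=> rf rg.
apply: eq_realizable (realizable_wiring_seq (wiring_merge m) (realizable_par rf rg)).
by move=> x [|] //= <- _; rewrite take_size_cat ?drop_size_cat.
Qed.

(** * From phases to arbitrary states *)

Hypothesis two_neq0 : (2 : K) != 0.

(* The columns of this matrix are [(1, 1)] and [e_b]. *)
Lemma realizable_gate (b : bool) :
  realizable 1 1 (fun x y => (mask y x == mask y [:: b])%:R).
Proof.
have half : 2 * 2^-1 = 1 :> K by rewrite divff.
(* The columns of [D c] are [(1, 1)] and [(0, -2c)], so [c = -1/2] gives the gate of [true]. *)
pose D (c : K) := Seq (Hadamard K) (Seq (TriangleInv K) (Spider 1 1 c)).
have DE c i j : interp (D c) i j = 
    if j == 0 then 1 else if i == 0 then 0 else -2 * c.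
  rewrite !(spider_mxE, mxE, big_ord_recl, big_ord0) /=.
  case: j => [[|[|j]] ?] //; case: i => [[|[|i]] ?] //=;
  by rewrite ?(eqxx, mul1r, mul0r, mulr0, mulr1, addr0, add0r); ring.
case: b.
  exists (D (- 2^-1)) => i j; rewrite DE.
  case: j => [[|[|j]] ?] //; case: i => [[|[|i]] ?] //=.
  by rewrite mulrNN half.
(* The second column of [D (1/2)] is [(0, -1)]; the triangle adds the first column to it, giving
   [(1, 0)]. *)
exists (Seq (D 2^-1) (Triangle K)) => i j; rewrite [interp _]/= mxE.
rewrite !big_ord_recl big_ord0 !DE !mxE /=.
case: j => [[|[|j]] ?] //; case: i => [[|[|i]] ?] //=;
  rewrite ?mulNr ?half; ring.
Qed.

(** The input [y] selects the positions at which [x] must agree with [a]: none for the zero word,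
    all for the word of ones. *)
Lemma realizable_gates (a : bitseq) :
  realizable (size a) (size a) (fun x y => (mask y x == mask y a)%:R).
Proof.
elim: a => [|b a IHa] /=.
  by apply: eq_realizable (proj2 wiring_empty); case=> [|] // [|].
apply: eq_realizable (realizable_par (realizable_gate b) IHa).
case=> [|c x] // [|d y] //= _ _; rewrite !take0 !drop0 -natrM mulnb.
by case: d; rewrite //= eqseq_cons andbT.
Qed.

Lemma realizable_phase (a : bitseq) (c : K) :
  realizable 0 (size a) (fun x y => 1 + c * (x == a)%:R).
Proof.
apply: eq_realizable (realizable_seq (realizable_gates a) (realizable_spider 0 _ c)).
move=> x [|//] sx _ /=.
pose G z : K := (mask z x == mask z a)%:R.
(* Only the two constant words of the spider contribute: the zero word yields 1, the word of ones
   yields [c] at [x = a]. *)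
rewrite (eq_bigr (fun z => (z == nseq (size a) false)%:R * G z +
    (z == nseq (size a) true)%:R * (c * G z))); last by move=> z _; rewrite /G; ring.
rewrite big_split !sum_words_pred1 ?size_nseq // /G !mask_false eqxx.
by rewrite -{1}sx !mask_true.
Qed.

Lemma realizable_state m (v : bitseq -> K) : realizable 0 m (fun x y => v x).
Proof.
(* With the constant [v a - 1], the factor of [a] is [v a] at [x = a] and 1 elsewhere. *)
have prod_phases s : all (fun a => size a == m) s ->
    realizable 0 m (fun x y => \prod_(a <- s) (1 + (v a - 1) * (x == a)%:R)).
  elim: s => [_|a s IHs /= /andP [/eqP sa /IHs rs]].
    (* The empty product is the all-ones state, a phase state with [c = 0]. *)
    have := realizable_phase (nseq m false) 0; rewrite size_nseq.
    by apply: eq_realizable => x y _ _; rewrite big_nil mul0r addr0.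
  have ra := realizable_phase a (v a - 1); rewrite sa in ra.
  by apply: eq_realizable (realizable_state_mul ra rs) => x y _ _; rewrite big_cons.
have /prod_phases : all (fun a => size a == m) (words m).
  by apply/allP => a; rewrite mem_words.
apply: eq_realizable => x y /eqP; rewrite -mem_words => x_in _.
rewrite (bigD1_seq x) ?uniq_words //= eqxx mulr1 big1 ?mulr1.
  by rewrite addrC subrK.
by move=> a /negbTE ax; rewrite eq_sym ax mulr0 addr0.
Qed.

Lemma realizable_all n m (f : bitseq -> bitseq -> K) : realizable n m f.
Proof.
elim: n m f => [|n IHn] m f.
  by apply: eq_realizable (realizable_state m (f^~ [::])) => x [].
(* The first input of [f] becomes an extra leading output, beside a bare wire that carries the
   actual input bit; the cup then joins the two. *)
have bent := realizable_par (proj2 wiring_wire)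
  (IHn m.+1 (fun x y => f (behead x) (head false x :: y))).
have cup := realizable_par realizable_cup (proj2 (wiring_wires m)).
apply: eq_realizable (realizable_seq cup bent).
move=> x [|b y] // sx _.
(* Wire and cup force the first two middle bits to equal [b], and the other wires force the rest to
   be [x], so only [[:: b, b & x]] contributes. *)
pose G z : K := (nth false z 1 == b)%:R * f (drop 2 z) (nth false z 1 :: y).
have -> : f x (b :: y) = G [:: b, b & x] by rewrite /G /= eqxx drop0 mul1r.
rewrite -(@sum_words_pred1 _ (2 + m)); last by rewrite /= sx.
apply: eq_big_seq.
rewrite /G => -[|c [|d z]]; rewrite mem_words //= => _.
rewrite !take0 !drop0 /= !eqseq_cons.
by case: c d b {G} => [] [] [] /=; rewrite ?(mul0r, mulr0, mul1r, mulr1).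
Qed.

End Realizable.

Theorem theorem5p1 (R : realType) (m n : nat) (A : 'M[R[i]]_(2 ^ m, 2 ^ n)) :
  exists D : zx R[i] n m, interp D = A.
Proof.
have two_neq0 : 2 != 0 :> R[i] by rewrite Num.Theory.pnatr_eq0.
(* Reads [A] as a function of words by decoding them to indices; the default 0 is never met at words
   of the form [bits m i], [bits n j], and injectivity of [bits] identifies the index found. *)
have [D DA] := realizable_all two_neq0 n m (fun x y =>
  if [pick k : 'I_(2 ^ m) * 'I_(2 ^ n) | (bits m k.1, bits n k.2) == (x, y)]
  is Some k then A k.1 k.2 else 0).
exists D; apply/matrixP => i j; rewrite DA.
case: pickP => [[k l] /eqP [eq_k eq_l] | /(_ (i, j))]; last by rewrite eqxx.
by congr (A _ _); apply: val_inj; apply: bits_inj (ltn_ord _) (ltn_ord _) _.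
Qed.
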